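(* Given a real number $\nu\geq\frac12$, $$\forall n>\nu,\quad j_{\nu,n+1}-j_{\nu,n}\leq2\pi,$$ where $n$ ranges over the positive integers.
   Context: For $\nu\ge0$, $J_\nu$ denotes the Bessel function of the first kind of order $\nu$ and $0<j_{\nu,1}<j_{\nu,2}<\cdots$ denotes the increasing sequence of its positive zeros. *)

(* Defs.v *)
(* Stdlib reals with Coquelicot. *)
From Stdlib Require Import Reals Factorial.
From Coquelicot Require Import Coquelicot.
Open Scope R_scope.

(* Euler's integral; meaningful for s > 0, where it converges. *)
Definition Gamma (s : R) : R :=
  RInt_gen (fun t => Rpower t (s - 1) * exp (- t))
           (at_right 0) (Rbar_locally p_infty).

(* Only meaningful for x > 0: [Rpower] is the real power of a positive base,
   and is junk elsewhere. *)
Definition BesselJ (nu x : R) : R :=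
  Rpower (x / 2) nu *
  Series (fun k : nat =>
            (-1) ^ k / (INR (fact k) * Gamma (nu + INR k + 1))
            * (x / 2) ^ (2 * k)).

(* [j n] is j_{nu,n} for n >= 1; the value [j 0] is unconstrained. *)
Definition is_BesselJ_zeros (nu : R) (j : nat -> R) : Prop :=
  (forall n : nat, (1 <= n)%nat -> 0 < j n /\ BesselJ nu (j n) = 0) /\
  (forall n : nat, (1 <= n)%nat -> j n < j (S n)) /\
  (forall x : R, 0 < x -> BesselJ nu x = 0 ->
     exists n : nat, (1 <= n)%nat /\ j n = x).

(* Main.v *)
(* The function u x = sqrt x * J_nu x satisfies u'' = - q u with
   q x = 1 - (nu^2 - 1/4) / x^2.  As nu >= 1/2, q <= 1, so by Sturm comparison
   with sin (x - a) consecutive zeros are at least PI apart; the power series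
   shows that J_nu does not vanish on (0, 1), whence j_n >= 1 + (n - 1) PI.  If
   n > nu, this forces j_n^2 >= (4/3) (nu^2 - 1/4), that is q >= 1/4 on
   [j_n, +oo), and Sturm comparison with sin ((x - a) / 2) bounds the next gap
   by 2 PI.  The differential equation is read off the power series, using
   Gamma (s + 1) = s * Gamma s. *)
Require Import Defs.
From Stdlib Require Import Reals Lra Lia Factorial.
From Coquelicot Require Import Coquelicot.
Open Scope R_scope.

(** * Improper integrals over the positive half-line *)

Lemma exp_le (x y : R) : x <= y -> exp x <= exp y.
Proof.
intros [H | ->]; [now apply Rlt_le, exp_increasing | apply Rle_refl].
Qed.

Lemma at_right_0_Ioo (e : R) : 0 < e -> at_right 0 (fun x => 0 < x < e).
Proof.
intros He. exists (mkposreal e He). intros x Hx Hx0.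
unfold ball in Hx; simpl in Hx; unfold AbsRing_ball, abs, minus, plus, opp in Hx; simpl in Hx.
apply Rabs_def2 in Hx. lra.
Qed.

Lemma ex_RInt_continuous_pos (f : R -> R) (a b : R) :
  (forall x, 0 < x -> continuous f x) -> 0 < a -> 0 < b -> ex_RInt f a b.
Proof.
intros Hc Ha Hb. apply (ex_RInt_continuous (V := R_CompleteNormedModule)).
intros z Hz. apply Hc. apply Rlt_le_trans with (2 := proj1 Hz).
now apply Rmin_glb_lt.
Qed.

(** The limit [L] is the supremum of the integrals over compact subintervals. As [f] is positive,
    enlarging the interval increases the integral, so every interval containing a nearly optimal
    [[a0, b0]] gives a value within [eps] of [L]. *)
Lemma ex_RInt_gen_pos_bounded (f : R -> R) (M : R) :
  (forall x, 0 < x -> continuous f x) ->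
  (forall x, 0 < x -> 0 < f x) ->
  (forall a b, 0 < a -> a <= b -> RInt f a b <= M) ->
  exists L, 0 < L /\ is_RInt_gen f (at_right 0) (Rbar_locally p_infty) L.
Proof.
intros Hc Hp HM.
destruct (completeness (fun y => exists a b, 0 < a /\ a <= b /\ y = RInt f a b))
  as [L [HL1 HL2]].
{ exists M. intros y (a & b & Ha & Hab & ->). now apply HM. }
{ exists (RInt f 1 1), 1, 1. repeat split; lra. }
assert (Hex := fun a b => ex_RInt_continuous_pos f a b Hc).
assert (Hup : forall a b, 0 < a -> a <= b -> RInt f a b <= L).
{ intros a b Ha Hab. apply HL1. now exists a, b. }
assert (Hge : forall a b, 0 < a -> a <= b -> 0 <= RInt f a b).
{ intros a b Ha Hab. apply RInt_ge_0; try easy. apply Hex; lra.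
  intros x Hx. apply Rlt_le, Hp. lra. }
exists L. split.
{ apply Rlt_le_trans with (RInt f 1 2).
  - apply RInt_gt_0; [lra | intros; apply Hp; lra | intros; apply Hc; lra].
  - apply Hup; lra. }
intros P [eps HP].
assert (Hnear : exists a b, 0 < a /\ a <= b /\ L - eps < RInt f a b).
{ apply Classical_Prop.NNPP. intros Hn.
  assert (L <= L - eps); [|destruct eps; simpl in *; lra].
  apply HL2. intros y (a & b & Ha & Hab & ->).
  apply Rnot_lt_le. intros Hlt. apply Hn. now exists a, b. }
destruct Hnear as (a0 & b0 & Ha0 & Hab0 & Hab).
apply Filter_prod with (fun a => 0 < a < a0) (fun b => b0 < b).
- now apply at_right_0_Ioo.
- now exists b0.
- intros a b [Ha1 Ha2] Hb. simpl.
  exists (RInt f a b). split.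
  { apply (RInt_correct (V := R_CompleteNormedModule)), Hex; lra. }
  apply HP.
  assert (E1 : RInt f a b = RInt f a a0 + RInt f a0 b0 + RInt f b0 b).
  { rewrite <- (RInt_Chasles (V := R_CompleteNormedModule) f a b0 b) by (apply Hex; lra).
    rewrite <- (RInt_Chasles (V := R_CompleteNormedModule) f a a0 b0) by (apply Hex; lra).
    reflexivity. }
  assert (H1 := Hge a a0 Ha1 (Rlt_le _ _ Ha2)).
  assert (H2 := Hge b0 b ltac:(lra) (Rlt_le _ _ Hb)).
  assert (H3 := Hup a b Ha1 ltac:(lra)).
  unfold ball; simpl; unfold AbsRing_ball, abs, minus, plus, opp; simpl.
  destruct eps as [e He]; simpl in *.
  apply Rabs_def1; lra.
Qed.

(** The fundamental theorem of calculus on the open half-line. Nothing is known of [F] at or below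
    0, so [Derive F] is replaced by [f] only eventually along the product filter, where both
    endpoints are positive. *)
Lemma is_RInt_gen_antiderivative_pos (F f : R -> R) (la lb : R) :
  (forall x, 0 < x -> is_derive F x (f x)) ->
  (forall x, 0 < x -> continuous f x) ->
  filterlim F (at_right 0) (locally la) ->
  filterlim F (Rbar_locally p_infty) (locally lb) ->
  is_RInt_gen f (at_right 0) (Rbar_locally p_infty) (lb - la).
Proof.
intros HF Hc Ha Hb.
assert (Hpos : forall P : R -> Prop, (forall x, 0 < x -> P x) ->
  filter_prod (at_right 0) (Rbar_locally p_infty)
    (fun ab => forall x, Rmin (fst ab) (snd ab) <= x <= Rmax (fst ab) (snd ab) -> P x)).
{ intros P HP. apply Filter_prod with (fun a => 0 < a < 1) (fun b => 0 < b).
  - apply at_right_0_Ioo; lra.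
  - now exists 0.
  - intros a b [Ha1 _] Hb1 x [Hx _]. apply HP. simpl in Hx.
    apply Rlt_le_trans with (2 := Hx). now apply Rmin_glb_lt. }
apply is_RInt_gen_ext with (Derive F).
{ generalize (Hpos (fun x => Derive F x = f x)
    (fun x Hx => is_derive_unique F x (f x) (HF x Hx))).
  apply filter_imp. intros ab H x Hx. apply H. lra. }
apply is_RInt_gen_Derive; trivial; apply Hpos; intros x Hx.
- exists (f x). now apply HF.
- apply continuous_ext_loc with f; [|now apply Hc].
  exists (mkposreal x Hx). intros y Hy. symmetry. apply is_derive_unique, HF.
  unfold ball in Hy; simpl in Hy; unfold AbsRing_ball, abs, minus, plus, opp in Hy; simpl in Hy.
  apply Rabs_def2 in Hy. lra.
Qed.

(** * Convergence and functional equation of the Gamma integral *)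

Lemma continuous_Rpower_exp_neg (p x : R) :
  0 < x -> continuous (fun t => Rpower t p * exp (- t)) x.
Proof.
intros Hx. apply (ex_derive_continuous (V := R_NormedModule)).
unfold Rpower. auto_derive. exact Hx.
Qed.

(* From [1 + y <= exp y] at [y = ln (t / (2 * p))]. *)
Lemma Rpower_exp_neg_bound (p : R) : 0 < p ->
  exists C, 0 < C /\ forall t, 0 < t -> Rpower t p * exp (- t) <= C * exp (- (t / 2)).
Proof.
intros Hp. exists (exp (p * ln (2 * p))). split. { apply exp_pos. }
intros t Ht. unfold Rpower. rewrite <- !exp_plus. apply exp_le.
assert (H := exp_ineq1_le (ln (t / (2 * p)))).
assert (0 < t / (2 * p)) by (apply Rdiv_lt_0_compat; lra).
rewrite exp_ln in H by assumption.
unfold Rdiv in H. rewrite ln_mult, ln_Rinv in H; try lra; [|apply Rinv_0_lt_compat; lra].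
assert (p * (1 + (ln t + - ln (2 * p))) <= p * (t * / (2 * p))) by (apply Rmult_le_compat_l; lra).
replace (p * (t * / (2 * p))) with (t / 2) in H1 by (field; lra).
nra.
Qed.

(** [Gamma] is a total function, so convergence has to be established before its value can be used.
    For [s > 1] the integrand is dominated by [C * exp (- (t / 2))] down to 0, whence the bound
    [2 * C]. The Bessel coefficients only involve arguments [nu + k + 1 > 1]. *)
Lemma is_RInt_gen_Gamma (s : R) : 1 < s ->
  0 < Gamma s /\
  is_RInt_gen (fun t => Rpower t (s - 1) * exp (- t))
    (at_right 0) (Rbar_locally p_infty) (Gamma s).
Proof.
intros Hs.
destruct (Rpower_exp_neg_bound (s - 1)) as (C & HC & Hb); [lra|].
assert (Hc := continuous_Rpower_exp_neg (s - 1)).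
destruct (ex_RInt_gen_pos_bounded (fun t => Rpower t (s - 1) * exp (- t)) (2 * C))
  as (L & HL & HI); trivial.
- intros x _. apply Rmult_lt_0_compat; apply exp_pos.
- intros a b Ha Hab.
  assert (HR : is_RInt (fun t => C * exp (- (t / 2))) a b
                 (minus (- 2 * C * exp (- (b / 2))) (- 2 * C * exp (- (a / 2))))).
  { apply (is_RInt_derive (V := R_CompleteNormedModule) (fun t => - 2 * C * exp (- (t / 2)))); intros x _.
    - auto_derive; [trivial | lra].
    - apply (ex_derive_continuous (V := R_NormedModule)). now auto_derive. }
  apply Rle_trans with (RInt (fun t => C * exp (- (t / 2))) a b).
  + apply RInt_le; trivial.
    * apply ex_RInt_continuous_pos; trivial; lra.
    * eexists; apply HR.
    * intros x Hx. apply Hb. lra.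
  + rewrite (is_RInt_unique _ _ _ _ HR).
    unfold minus, plus, opp; simpl.
    assert (exp (- (a / 2)) <= exp 0) by (apply exp_le; lra).
    rewrite exp_0 in H. assert (H1 := exp_pos (- (b / 2))). nra.
- assert (E : Gamma s = L).
  { unfold Gamma. apply is_RInt_gen_unique; [..|exact HI]; apply Proper_StrongProper; typeclasses eauto. }
  rewrite E. now split.
Qed.

(** Integration by parts: the derivative of [- t^s * exp (- t)] is the difference of the two
    integrands, and both boundary limits are 0. *)
Lemma Gamma_succ (s : R) : 1 < s -> Gamma (s + 1) = s * Gamma s.
Proof.
intros Hs.
set (B := fun t => - (Rpower t s * exp (- t))).
assert (HB : is_RInt_gen
  (fun t => Rpower t (s + 1 - 1) * exp (- t) - s * (Rpower t (s - 1) * exp (- t)))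
  (at_right 0) (Rbar_locally p_infty) (0 - 0)).
{ apply is_RInt_gen_antiderivative_pos with B.
  - intros x Hx. unfold B, Rpower. auto_derive; trivial.
    replace ((s + 1 - 1) * ln x) with (s * ln x) by ring.
    replace ((s - 1) * ln x) with (s * ln x + - ln x) by ring.
    rewrite exp_plus, (exp_Ropp (ln x)), exp_ln by trivial. field. lra.
  - intros x Hx. apply (ex_derive_continuous (V := R_NormedModule)).
    unfold Rpower. auto_derive. lra.
  (* At 0: for [t < 1] and [s > 1], [t^s * exp (- t) <= t]. *)
  - apply filterlim_locally. intros eps.
    assert (He : 0 < Rmin 1 eps) by (apply Rmin_glb_lt; [lra | apply eps]).
    generalize (at_right_0_Ioo _ He). apply filter_imp. intros t [Ht1 Ht2].
    assert (t < 1) by (apply Rlt_le_trans with (1 := Ht2), Rmin_l).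
    assert (t < eps) by (apply Rlt_le_trans with (1 := Ht2), Rmin_r).
    unfold ball; simpl; unfold AbsRing_ball, abs, minus, plus, opp, B; simpl.
    assert (Hln : ln t < 0) by (rewrite <- ln_1; apply ln_increasing; lra).
    assert (Rpower t s * exp (- t) <= t).
    { unfold Rpower. rewrite <- exp_plus.
      apply Rle_trans with (exp (ln t)); [apply exp_le; nra | rewrite exp_ln; lra]. }
    assert (0 < Rpower t s * exp (- t)) by (apply Rmult_lt_0_compat; apply exp_pos).
    apply Rabs_def1; lra.
  - destruct (Rpower_exp_neg_bound s) as (C & HC & Hb); [lra|].
    apply filterlim_locally. intros eps.
    (* Beyond this threshold [exp (t / 2) >= 1 + t / 2 > C / eps], so the dominating
       [C * exp (- (t / 2))] is below [eps]. *)
    exists (2 * C / eps). intros t Ht.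
    assert (Ht0 : 0 < t).
    { apply Rlt_trans with (2 := Ht). apply Rdiv_lt_0_compat; [lra | apply eps]. }
    unfold ball; simpl; unfold AbsRing_ball, abs, minus, plus, opp, B; simpl.
    assert (H1 := Hb t Ht0).
    assert (H2 : 0 < Rpower t s * exp (- t)) by (apply Rmult_lt_0_compat; apply exp_pos).
    assert (H3 : C * exp (- (t / 2)) < eps).
    { destruct eps as [e He]; simpl in *.
      assert (H4 := exp_ineq1_le (t / 2)).
      assert (2 * C < e * t).
      { apply (Rmult_lt_compat_r e) in Ht; trivial. field_simplify in Ht; lra. }
      assert (C < e * exp (t / 2)) by nra.
      rewrite exp_Ropp. apply Rmult_lt_reg_r with (exp (t / 2)); [apply exp_pos|].
      rewrite Rmult_assoc, Rinv_l; [lra | apply Rgt_not_eq, exp_pos]. }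
    apply Rabs_def1; lra. }
destruct (is_RInt_gen_Gamma s Hs) as [_ H1].
destruct (is_RInt_gen_Gamma (s + 1)) as [_ H2]; [lra|].
assert (H3 := is_RInt_gen_plus _ _ _ _ HB (is_RInt_gen_scal _ s _ H1)).
unfold plus, scal in H3; simpl in H3; unfold mult in H3; simpl in H3.
unfold Gamma at 1. apply is_RInt_gen_unique; try (apply Proper_StrongProper; typeclasses eauto).
replace (s * Gamma s) with (0 - 0 + s * Gamma s) by ring.
revert H3. apply is_RInt_gen_ext. apply filter_forall. intros ab x _. simpl. ring.
Qed.

(** * The power series of the Bessel function, in the variable [(x / 2) ^ 2] *)

Definition bessel_coef (nu : R) (k : nat) : R :=
  (-1) ^ k / (INR (fact k) * Gamma (nu + INR k + 1)).

Lemma BesselJ_PSeries (nu x : R) :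
  BesselJ nu x = Rpower (x / 2) nu * PSeries (bessel_coef nu) ((x / 2) ^ 2).
Proof.
unfold BesselJ, PSeries. f_equal. apply Series_ext. intros k.
now rewrite pow_mult.
Qed.

Lemma bessel_coef_neq_0 (nu : R) (k : nat) : 0 < nu -> bessel_coef nu k <> 0.
Proof.
intros Hnu. assert (Hk := pos_INR k).
destruct (is_RInt_gen_Gamma (nu + INR k + 1)) as [HG _]; [lra|].
assert (Hf := INR_fact_lt_0 k).
unfold bessel_coef, Rdiv. apply Rmult_integral_contrapositive_currified.
- apply pow_nonzero. lra.
- now apply Rinv_neq_0_compat, Rgt_not_eq, Rmult_lt_0_compat.
Qed.

(** Combines [Gamma_succ] with the recursion of the factorial. The radius of convergence, the
    differential equation and the decay of the coefficients all come from this recurrence. *)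
Lemma bessel_coef_succ (nu : R) (k : nat) : 0 < nu ->
  bessel_coef nu k = - (INR k + 1) * (nu + INR k + 1) * bessel_coef nu (S k).
Proof.
intros Hnu. assert (Hk := pos_INR k).
destruct (is_RInt_gen_Gamma (nu + INR k + 1)) as [HG _]; [lra|].
assert (Hf := INR_fact_lt_0 k).
unfold bessel_coef.
rewrite fact_simpl, mult_INR, S_INR.
replace (nu + (INR k + 1) + 1) with (nu + INR k + 1 + 1) by ring.
rewrite (Gamma_succ (nu + INR k + 1)) by lra. simpl pow. field. repeat split; lra.
Qed.

Lemma Rabs_bessel_coef_succ (nu : R) (k : nat) : 0 < nu ->
  Rabs (bessel_coef nu (S k)) * ((INR k + 1) * (nu + INR k + 1)) = Rabs (bessel_coef nu k).
Proof.
intros Hnu. assert (Hk := pos_INR k).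
rewrite (bessel_coef_succ nu k Hnu), Rabs_mult, Rmult_comm. f_equal.
rewrite <- (Rabs_pos_eq ((INR k + 1) * (nu + INR k + 1))) by nra.
rewrite <- Rabs_Ropp. f_equal. ring.
Qed.

(** Ratio test: consecutive coefficients have ratio [1 / ((k + 1) * (nu + k + 1))] in absolute
    value, which is at most [1 / (k + 1)]. *)
Lemma CV_radius_bessel_coef (nu : R) : 0 < nu -> CV_radius (bessel_coef nu) = p_infty.
Proof.
intros Hnu. apply CV_radius_infinite_DAlembert.
{ intros n. now apply bessel_coef_neq_0. }
apply (is_lim_seq_le_le (fun _ => 0) _ (fun n => / INR (S n))).
- intros n. split; [apply Rabs_pos|].
  assert (H0 := bessel_coef_neq_0 nu n Hnu).
  rewrite Rabs_div by trivial.
  rewrite <- (Rabs_bessel_coef_succ nu n Hnu).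
  assert (H1 := Rabs_pos_lt _ (bessel_coef_neq_0 nu (S n) Hnu)).
  assert (Hk := pos_INR n). rewrite S_INR.
  replace (_ / _) with (/ (INR n + 1) * / (nu + INR n + 1)) by (field; repeat split; lra).
  rewrite <- (Rmult_1_r (/ (INR n + 1))) at 2.
  apply Rmult_le_compat_l; [apply Rlt_le, Rinv_0_lt_compat; lra|].
  rewrite <- Rinv_1. apply Rinv_le_contravar; lra.
- apply is_lim_seq_const.
- apply (is_lim_seq_incr_1 (fun n => / INR n)).
  replace (Finite 0) with (Rbar_inv p_infty) by reflexivity.
  apply is_lim_seq_inv; [apply is_lim_seq_INR | easy].
Qed.

(** The coefficient of [t^n] on the left is [(n + 1) * (nu + n + 1) * a (n + 1) + a n], which the
    recurrence makes zero. *)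
Lemma bessel_PSeries_ode (nu t : R) : 0 < nu ->
  t * PSeries (PS_derive (PS_derive (bessel_coef nu))) t
  + (nu + 1) * PSeries (PS_derive (bessel_coef nu)) t
  + PSeries (bessel_coef nu) t = 0.
Proof.
intros Hnu.
assert (Hex : forall a, CV_radius a = p_infty -> ex_pseries a t).
{ intros a Ha. apply CV_radius_inside. now rewrite Ha. }
assert (H0 := CV_radius_bessel_coef nu Hnu).
assert (H1 := H0). rewrite <- CV_radius_derive in H1.
assert (H2 := H1). rewrite <- CV_radius_derive in H2.
rewrite <- (PSeries_incr_1 (PS_derive (PS_derive (bessel_coef nu)))).
rewrite <- PSeries_scal.
rewrite <- PSeries_plus; [rewrite <- PSeries_plus|..].
- rewrite (PSeries_ext _ (fun _ => 0)).
  { apply PSeries_const_0. }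
  intros n. unfold PS_plus, PS_scal, PS_incr_1, PS_derive.
  (* The shift [PS_incr_1] has constant term 0, so [n = 0] is computed apart. *)
  rewrite (bessel_coef_succ nu n Hnu). destruct n as [|n].
  + unfold plus, scal; simpl; unfold mult, zero; simpl. ring.
  + rewrite !S_INR. unfold plus, scal; simpl; unfold mult; simpl. ring.
- apply ex_pseries_plus; [apply ex_pseries_incr_1; now apply Hex|].
  apply ex_pseries_scal; [apply Rmult_comm | now apply Hex].
- now apply Hex.
- apply ex_pseries_incr_1; now apply Hex.
- apply ex_pseries_scal; [apply Rmult_comm | now apply Hex].
Qed.

(** The constant term dominates: the absolute values of the coefficients do not increase, so the
    rest of the series is at most [Rabs (a 0) * t / (1 - t)], which is less than [Rabs (a 0)] when
    [t < 1 / 2]. *)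
Lemma bessel_PSeries_neq_0 (nu t : R) : 0 < nu -> 0 <= t < 1 / 2 ->
  PSeries (bessel_coef nu) t <> 0.
Proof.
intros Hnu Ht. set (a := bessel_coef nu).
assert (Ha0 := Rabs_pos_lt _ (bessel_coef_neq_0 nu 0 Hnu)). fold a in Ha0.
assert (Hle : forall k, Rabs (a k) <= Rabs (a O)).
{ induction k as [|k IH]; [lra|]. apply Rle_trans with (2 := IH).
  assert (H := Rabs_bessel_coef_succ nu k Hnu). fold a in H. rewrite <- H.
  assert (H1 := Rabs_pos (a (S k))). assert (H2 := pos_INR k).
  rewrite <- (Rmult_1_r (Rabs (a (S k)))) at 1. apply Rmult_le_compat_l; nra. }
assert (Hgeom : is_series (fun k => Rabs (a O) * t ^ k) (Rabs (a O) * / (1 - t))).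
{ apply (is_series_scal (V := R_NormedModule) (Rabs (a O))), is_series_geom.
  rewrite Rabs_pos_eq; lra. }
assert (Hdom : forall k, 0 <= Rabs (PS_decr_1 a k * t ^ k) <= Rabs (a O) * t ^ k).
{ intros k. split; [apply Rabs_pos|].
  assert (0 <= t ^ k) by (apply pow_le; lra).
  rewrite Rabs_mult, (Rabs_pos_eq (t ^ k)) by trivial.
  apply Rmult_le_compat_r; trivial. apply Hle. }
assert (Hb : Rabs (PSeries (PS_decr_1 a) t) <= Rabs (a O) * / (1 - t)).
{ unfold PSeries. rewrite <- (is_series_unique _ _ Hgeom).
  apply Rle_trans with (Series (fun k => Rabs (PS_decr_1 a k * t ^ k))).
  - apply Series_Rabs.
    apply (ex_series_le (V := R_CompleteNormedModule)) with (fun k => Rabs (a O) * t ^ k).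
    + intros k. unfold norm; simpl; unfold abs; simpl. rewrite Rabs_Rabsolu. apply Hdom.
    + now exists (Rabs (a O) * / (1 - t)).
  - apply Series_le; [exact Hdom | now exists (Rabs (a O) * / (1 - t))]. }
rewrite PSeries_decr_1.
2: { apply CV_radius_inside. unfold a. now rewrite CV_radius_bessel_coef. }
intros Habs.
assert (E : Rabs (a O) = t * Rabs (PSeries (PS_decr_1 a) t)).
{ replace (a O) with (- (t * PSeries (PS_decr_1 a) t)) by lra.
  rewrite Rabs_Ropp, Rabs_mult, (Rabs_pos_eq t); lra. }
assert (Hmul : t * Rabs (PSeries (PS_decr_1 a) t) * (1 - t) <= t * Rabs (a O)).
{ rewrite Rmult_assoc. apply Rmult_le_compat_l; [lra|].
  apply Rmult_le_compat_r with (r := 1 - t) in Hb; [|lra].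
  rewrite Rmult_assoc, Rinv_l in Hb; lra. }
rewrite <- E in Hmul. nra.
Qed.

(** * Bessel's equation in normal form *)

(* [Rpower x (nu + 1/2)] times the power series is, up to a constant factor,
   [sqrt x * BesselJ nu x]: the Liouville normal form of Bessel's equation. *)
Definition bessel_u (nu x : R) : R :=
  Rpower x (nu + 1 / 2) * PSeries (bessel_coef nu) ((x / 2) ^ 2).

Definition bessel_u' (nu x : R) : R :=
  Rpower x (nu + 1 / 2) *
  ((nu + 1 / 2) / x * PSeries (bessel_coef nu) ((x / 2) ^ 2)
   + x / 2 * PSeries (PS_derive (bessel_coef nu)) ((x / 2) ^ 2)).

Lemma is_derive_PSeries_half_sqr (a : nat -> R) (x : R) : CV_radius a = p_infty ->
  is_derive (fun x => PSeries a ((x / 2) ^ 2)) x (x / 2 * PSeries (PS_derive a) ((x / 2) ^ 2)).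
Proof.
intros Ha.
apply (is_derive_comp (V := R_NormedModule) (PSeries a) (fun x => (x / 2) ^ 2)).
- apply is_derive_PSeries. now rewrite Ha.
- auto_derive; [trivial | field].
Qed.

Lemma is_derive_Rpower (p x : R) : 0 < x ->
  is_derive (fun x => Rpower x p) x (Rpower x p * (p / x)).
Proof.
intros Hx. unfold Rpower. auto_derive; [trivial | field; lra].
Qed.

Lemma is_derive_bessel_u (nu x : R) : 0 < nu -> 0 < x ->
  is_derive (bessel_u nu) x (bessel_u' nu x).
Proof.
intros Hnu Hx. unfold bessel_u, bessel_u'.
assert (HP := is_derive_PSeries_half_sqr _ x (CV_radius_bessel_coef nu Hnu)).
assert (H := is_derive_mult _ _ _ _ _ (is_derive_Rpower (nu + 1 / 2) x Hx) HP Rmult_comm).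
unfold plus, mult in H; simpl in H. simpl pow in *.
evar_last; [exact H|]. simpl. ring.
Qed.

Lemma is_derive_bessel_u' (nu x : R) : 0 < nu -> 0 < x ->
  is_derive (bessel_u' nu) x (- (1 - (nu ^ 2 - 1 / 4) / x ^ 2) * bessel_u nu x).
Proof.
intros Hnu Hx. unfold bessel_u, bessel_u'.
assert (H0 := CV_radius_bessel_coef nu Hnu).
assert (H1 := H0). rewrite <- CV_radius_derive in H1.
assert (HP0 := is_derive_PSeries_half_sqr _ x H0).
assert (HP1 := is_derive_PSeries_half_sqr _ x H1).
assert (Hc : is_derive (fun x => (nu + 1 / 2) / x) x (- (nu + 1 / 2) / x ^ 2)).
{ auto_derive; [lra | field; lra]. }
assert (Hl : is_derive (fun x => x / 2) x (1 / 2)) by (auto_derive; [trivial | field]).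
assert (H := is_derive_mult _ _ _ _ _ (is_derive_Rpower (nu + 1 / 2) x Hx)
  (is_derive_plus (V := R_NormedModule) _ _ _ _ _
     (is_derive_mult _ _ _ _ _ Hc HP0 Rmult_comm)
     (is_derive_mult _ _ _ _ _ Hl HP1 Rmult_comm)) Rmult_comm).
unfold plus, mult in H; simpl in H. simpl pow in *.
evar_last; [exact H|].
assert (Hode := bessel_PSeries_ode nu ((x / 2) ^ 2) Hnu). simpl pow in Hode.
set (g := PSeries (bessel_coef nu) _) in *.
set (g' := PSeries (PS_derive (bessel_coef nu)) _) in *.
set (g'' := PSeries (PS_derive (PS_derive (bessel_coef nu))) _) in *.
(* Once the series equation eliminates [g], what remains is an identity of rational functions with
   [g'] and [g''] free. *)
replace g with (- (x / 2 * (x / 2 * 1) * g'' + (nu + 1) * g')) by lra.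
simpl. field. lra.
Qed.

Lemma bessel_u_eq_0 (nu x : R) : bessel_u nu x = 0 <-> BesselJ nu x = 0.
Proof.
assert (Hp : forall y p, Rpower y p <> 0) by (intros; apply Rgt_not_eq, exp_pos).
rewrite BesselJ_PSeries. unfold bessel_u.
split; intros H; apply Rmult_integral in H; destruct H as [H|H];
  try (now apply Hp in H); rewrite H; ring.
Qed.

(** * Sturm comparison with a sine *)

Lemma derive_ge_0_le (f df : R -> R) (a b : R) : a <= b ->
  (forall x, a <= x <= b -> is_derive f x (df x)) ->
  (forall x, a <= x <= b -> 0 <= df x) -> f a <= f b.
Proof.
intros Hab Hd Hp.
destruct (MVT_gen f a b df) as (c & Hc & E);
  rewrite ?Rmin_left, ?Rmax_right in * by trivial.
- intros x Hx. apply Hd. lra.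
- intros x Hx. apply continuity_pt_filterlim.
  apply (ex_derive_continuous (V := R_NormedModule)). eexists. now apply Hd.
- assert (H := Hp c Hc). assert (0 <= df c * (b - a)) by (apply Rmult_le_pos; lra). lra.
Qed.

(** The function is the Wronskian of [u] and [sin (m * (x - a))], the latter solving
    [s'' = - m^2 * s]. The first-order terms cancel, leaving a derivative whose sign is governed by
    [m^2 - q]. *)
Lemma is_derive_wronskian_sin (u u' q : R -> R) (m a x : R) :
  is_derive u x (u' x) -> is_derive u' x (- q x * u x) ->
  is_derive (fun x => u' x * sin (m * (x - a)) - u x * (m * cos (m * (x - a)))) x
    ((m ^ 2 - q x) * u x * sin (m * (x - a))).
Proof.
intros H1 H2.
assert (E1 := is_derive_unique _ _ _ H1). assert (E2 := is_derive_unique _ _ _ H2).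
assert (ex_derive u x) by (eexists; apply H1). assert (ex_derive u' x) by (eexists; apply H2).
auto_derive; [repeat split; trivial|].
change (Derive (fun x => u x) x) with (Derive u x).
change (Derive (fun x => u' x) x) with (Derive u' x).
rewrite E1, E2. unfold Rminus. ring.
Qed.

Lemma no_zero_same_sign (u : R -> R) (a b : R) :
  (forall x, a < x < b -> continuous u x) ->
  (forall x, a < x < b -> u x <> 0) ->
  (forall x, a < x < b -> 0 < u x) \/ (forall x, a < x < b -> u x < 0).
Proof.
intros Hc Hn.
assert (Hprod : forall x y, a < x -> x < y -> y < b -> 0 < u x * u y).
{ intros x y Hx Hxy Hy.
  apply Rnot_le_lt. intros Hle.
  (* Multiplying by [- u x] makes the function negative at [x] whatever the sign of [u x], so the
     increasing form of the intermediate value theorem applies. *)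
  assert (Hcu : forall z, x <= z <= y -> continuity_pt (fun z => u z * - u x) z).
  { intros z Hz. apply continuity_pt_filterlim.
    apply (continuous_mult (K := R_AbsRing) u (fun _ => - u x)); [apply Hc; lra | apply continuous_const]. }
  destruct (IVT_Rbar_incr (fun z => u z * - u x) x y (u x * - u x) (u y * - u x) 0)
    as (z & Hz1 & Hz2 & Hz3); simpl in *; try easy.
  - apply (is_lim_continuity (fun z => u z * - u x)), Hcu. lra.
  - apply (is_lim_continuity (fun z => u z * - u x)), Hcu. lra.
  - intros z Hz1 Hz2. apply Hcu. lra.
  - assert (H0 := Rsqr_pos_lt (u x) (Hn x ltac:(lra))). unfold Rsqr in H0.
    assert (H1 := Rmult_integral_contrapositive_currified _ _ (Hn x ltac:(lra)) (Hn y ltac:(lra))).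
    split; lra.
  - apply Rmult_integral in Hz3. destruct Hz3 as [Hz3|Hz3].
    + revert Hz3. apply Hn. lra.
    + apply (Hn x); lra. }
destruct (Rle_lt_dec b a) as [Hab|Hab]; [left; intros; lra|].
set (m := (a + b) / 2).
assert (Hm : a < m < b) by (unfold m; lra).
assert (Hx : forall x, a < x < b -> 0 < u x * u m).
{ intros x Hx. destruct (Rtotal_order x m) as [H|[->|H]].
  - apply Hprod; lra.
  - assert (H := Hn m Hm). nra.
  - rewrite Rmult_comm. apply Hprod; lra. }
destruct (Rlt_le_dec 0 (u m)); [left|right]; intros x Hx'; specialize (Hx x Hx'); nra.
Qed.

(* If [b < a + PI / m], the quotient [u x / sin (m * (x - a))] is nondecreasing
   on [(a, b]] and positive inside, hence cannot vanish at [b]. *)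
Lemma sturm_gap_ge_pos (u u' q : R -> R) (m a b : R) :
  0 < m -> a < b ->
  (forall x, a <= x <= b -> is_derive u x (u' x)) ->
  (forall x, a <= x <= b -> is_derive u' x (- q x * u x)) ->
  (forall x, a <= x <= b -> q x <= m ^ 2) ->
  (forall x, a < x < b -> 0 < u x) -> u a = 0 -> u b = 0 ->
  PI / m <= b - a.
Proof.
intros Hm Hab H1 H2 Hq Hp Ha Hb.
apply Rnot_lt_le. intros Hlt.
assert (HPI : m * (b - a) < PI).
{ apply (Rmult_lt_compat_l m) in Hlt; trivial. now replace (m * (PI / m)) with PI in Hlt by (field; lra). }
assert (Hs : forall x, a < x <= b -> 0 < sin (m * (x - a))).
{ intros x Hx. apply sin_gt_0; [|apply Rle_lt_trans with (2 := HPI)]; nra. }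
assert (Hu : forall x, a <= x <= b -> 0 <= u x).
{ intros x Hx. destruct (Req_dec x a) as [->|]; [lra|].
  destruct (Req_dec x b) as [->|]; [lra|]. apply Rlt_le, Hp. lra. }
(* The quotient [u x / sin (m * (x - a))] has derivative [W x / sin (m * (x - a)) ^ 2], so its
   monotonicity amounts to [0 <= W]. *)
set (W := fun x => u' x * sin (m * (x - a)) - u x * (m * cos (m * (x - a)))).
assert (HW : forall x, a <= x <= b -> 0 <= W x).
{ intros x Hx. replace 0 with (W a).
  2: { unfold W. rewrite Ha, Rminus_diag, Rmult_0_r, sin_0. ring. }
  apply derive_ge_0_le with (fun x => (m ^ 2 - q x) * u x * sin (m * (x - a))); [lra|..].
  - intros y Hy. apply is_derive_wronskian_sin; [apply H1 | apply H2]; lra.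
  - intros y Hy. assert (q y <= m ^ 2) by (apply Hq; lra).
    apply Rmult_le_pos; [apply Rmult_le_pos; [lra | apply Hu; lra]|].
    destruct (Req_dec y a) as [->|]; [|apply Rlt_le, Hs; lra].
    rewrite Rminus_diag, Rmult_0_r, sin_0. lra. }
(* The sine vanishes at [a], so the quotient is compared between an interior point and [b]. *)
set (c := (a + b) / 2). assert (Hc : a < c < b) by (unfold c; lra).
assert (Hmono : u c / sin (m * (c - a)) <= u b / sin (m * (b - a))).
{ apply (derive_ge_0_le (fun x => u x / sin (m * (x - a))) (fun x => W x / sin (m * (x - a)) ^ 2)); [lra|..].
  - intros x Hx. assert (Hsx : 0 < sin (m * (x - a))) by (apply Hs; lra).
    assert (D1 : is_derive u x (u' x)) by (apply H1; lra).
    assert (E1 := is_derive_unique _ _ _ D1).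
    assert (ex_derive u x) by (eexists; apply D1).
    unfold W. auto_derive; [repeat split; trivial; unfold Rminus in Hsx; lra|].
    change (Derive (fun x => u x) x) with (Derive u x).
    rewrite E1. unfold Rminus in *. field. lra.
  - intros x Hx. assert (Hsx : 0 < sin (m * (x - a))) by (apply Hs; lra).
    apply Rdiv_le_0_compat; [apply HW; lra | now apply pow_lt]. }
rewrite Hb in Hmono.
assert (0 < u c / sin (m * (c - a))) by (apply Rdiv_lt_0_compat; [now apply Hp | apply Hs; lra]).
lra.
Qed.

(* If [a + PI / m < b], the Wronskian with [sin (m * (x - a))] vanishes at [a]
   and is nonincreasing, but equals [m * u > 0] at [a + PI / m]. *)
Lemma sturm_gap_le_pos (u u' q : R -> R) (m a b : R) :
  0 < m -> a < b ->
  (forall x, a <= x <= b -> is_derive u x (u' x)) ->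
  (forall x, a <= x <= b -> is_derive u' x (- q x * u x)) ->
  (forall x, a <= x <= b -> m ^ 2 <= q x) ->
  (forall x, a < x < b -> 0 < u x) -> u a = 0 ->
  b - a <= PI / m.
Proof.
intros Hm Hab H1 H2 Hq Hp Ha.
apply Rnot_lt_le. intros Hlt.
set (c := a + PI / m).
assert (Hmc : m * (c - a) = PI) by (unfold c; field; lra).
assert (0 < PI / m) by (apply Rdiv_lt_0_compat; [apply PI_RGT_0 | trivial]).
assert (Hc : a < c < b) by (unfold c; lra).
(* The Wronskian is negated so as to be nondecreasing, as [derive_ge_0_le] requires; then
   [W c = - m * u c]. *)
set (W := fun x => - (u' x * sin (m * (x - a)) - u x * (m * cos (m * (x - a))))).
assert (HW : W a <= W c).
{ apply derive_ge_0_le with (fun x => - ((m ^ 2 - q x) * u x * sin (m * (x - a)))); [lra|..].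
  - intros y Hy. apply (is_derive_opp (V := R_NormedModule)).
    apply is_derive_wronskian_sin; [apply H1 | apply H2]; lra.
  - intros y Hy. assert (m ^ 2 <= q y) by (apply Hq; lra).
    replace (- _) with ((q y - m ^ 2) * u y * sin (m * (y - a))) by ring.
    apply Rmult_le_pos; [apply Rmult_le_pos; [lra|]|].
    + destruct (Req_dec y a) as [->|]; [lra | apply Rlt_le, Hp; lra].
    + apply sin_ge_0; [|rewrite <- Hmc]; nra. }
unfold W in HW. rewrite Hmc, Ha, sin_PI, cos_PI, Rminus_diag, Rmult_0_r, sin_0 in HW.
assert (Hc' := Hp c Hc). nra.
Qed.

(** By linearity [- u] solves the same equation, which reduces the case of negative [u] to that of
    positive [u]. *)
Lemma is_derive_opp_ode (u u' q : R -> R) (x : R) :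
  is_derive u x (u' x) -> is_derive u' x (- q x * u x) ->
  is_derive (fun x => - u x) x (- u' x) /\ is_derive (fun x => - u' x) x (- q x * - u x).
Proof.
intros H1 H2. split.
- now apply (is_derive_opp (V := R_NormedModule) u).
- replace (- q x * - u x) with (- (- q x * u x)) by ring.
  now apply (is_derive_opp (V := R_NormedModule) u').
Qed.

Lemma sturm_gap (u u' q : R -> R) (m a b : R) :
  0 < m -> a < b ->
  (forall x, a <= x <= b -> is_derive u x (u' x)) ->
  (forall x, a <= x <= b -> is_derive u' x (- q x * u x)) ->
  (forall x, a < x < b -> u x <> 0) -> u a = 0 -> u b = 0 ->
  ((forall x, a <= x <= b -> q x <= m ^ 2) -> PI / m <= b - a) /\
  ((forall x, a <= x <= b -> m ^ 2 <= q x) -> b - a <= PI / m).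
Proof.
intros Hm Hab H1 H2 Hn Ha Hb.
assert (H3 := fun x Hx => proj1 (is_derive_opp_ode u u' q x (H1 x Hx) (H2 x Hx))).
assert (H4 := fun x Hx => proj2 (is_derive_opp_ode u u' q x (H1 x Hx) (H2 x Hx))).
destruct (no_zero_same_sign u a b) as [Hp|Hp]; trivial.
{ intros x Hx. apply (ex_derive_continuous (V := R_NormedModule)). exists (u' x). apply H1. lra. }
- split; intros Hq.
  + now apply (sturm_gap_ge_pos u u' q).
  + now apply (sturm_gap_le_pos u u' q).
- assert (Hp' : forall x, a < x < b -> 0 < - u x) by (intros x Hx; specialize (Hp x Hx); lra).
  split; intros Hq.
  + apply (sturm_gap_ge_pos (fun x => - u x) (fun x => - u' x) q); trivial; lra.
  + apply (sturm_gap_le_pos (fun x => - u x) (fun x => - u' x) q); trivial; lra.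
Qed.

(** * Location and spacing of the Bessel zeros *)

Lemma zeros_increasing (nu : R) (j : nat -> R) (n m : nat) :
  is_BesselJ_zeros nu j -> (1 <= n)%nat -> (n < m)%nat -> j n < j m.
Proof.
intros hj Hn Hm. destruct hj as (_ & Hinc & _).
induction Hm as [|m Hm IH]; [now apply Hinc|].
apply Rlt_trans with (1 := IH), Hinc. lia.
Qed.

Lemma bessel_u_neq_0_between (nu : R) (j : nat -> R) (n : nat) (x : R) :
  is_BesselJ_zeros nu j -> (1 <= n)%nat -> j n < x < j (S n) -> bessel_u nu x <> 0.
Proof.
intros hj Hn Hx H. destruct (hj) as (Hz & Hinc & Hall).
apply bessel_u_eq_0 in H. assert (Hjn := proj1 (Hz n Hn)).
destruct (Hall x) as (m & Hm & <-); trivial; [lra|].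
destruct (Nat.lt_trichotomy m n) as [Hmn|[->|Hmn]]; [|lra|].
- assert (H1 := zeros_increasing nu j m n hj Hm Hmn). lra.
- destruct (Nat.eq_dec m (S n)) as [->|Hne]; [lra|].
  assert (H1 := zeros_increasing nu j (S n) m hj ltac:(lia) ltac:(lia)). lra.
Qed.

(** The bounds on [q] are asked on all of [[j n, +oo)] because they will be derived from lower
    bounds on [j n] alone. *)
Lemma zeros_gap (nu : R) (j : nat -> R) (n : nat) (m : R) :
  1 / 2 <= nu -> is_BesselJ_zeros nu j -> (1 <= n)%nat -> 0 < m ->
  let q x := 1 - (nu ^ 2 - 1 / 4) / x ^ 2 in
  ((forall x, j n <= x -> q x <= m ^ 2) -> PI / m <= j (S n) - j n) /\
  ((forall x, j n <= x -> m ^ 2 <= q x) -> j (S n) - j n <= PI / m).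
Proof.
intros hnu hj Hn Hm q. destruct (hj) as (Hz & Hinc & Hall).
destruct (Hz n Hn) as [Hpos H0]. destruct (Hz (S n) ltac:(lia)) as [_ H1].
destruct (sturm_gap (bessel_u nu) (bessel_u' nu) q m (j n) (j (S n))) as [HA HB]; trivial.
- now apply Hinc.
- intros x Hx. apply is_derive_bessel_u; lra.
- intros x Hx. apply is_derive_bessel_u'; lra.
- intros x Hx. now apply (bessel_u_neq_0_between nu j n).
- now apply bessel_u_eq_0.
- now apply bessel_u_eq_0.
- split; intros Hq; [apply HA | apply HB]; intros x Hx; apply Hq; lra.
Qed.

Lemma zeros_ge_1 (nu : R) (j : nat -> R) (n : nat) :
  1 / 2 <= nu -> is_BesselJ_zeros nu j -> (1 <= n)%nat -> 1 <= j n.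
Proof.
intros hnu hj Hn. destruct hj as (Hz & _ & _). destruct (Hz n Hn) as [Hpos H0].
apply Rnot_lt_le. intros Hlt. rewrite BesselJ_PSeries in H0.
apply Rmult_integral in H0. destruct H0 as [H0|H0].
- revert H0. apply Rgt_not_eq, exp_pos.
- revert H0. apply bessel_PSeries_neq_0; [lra | nra].
Qed.

(** Induction from [1 <= j 1]; each gap is at least [PI] by comparison with [m = 1], since
    [nu >= 1 / 2] gives [q <= 1]. *)
Lemma zeros_ge (nu : R) (j : nat -> R) (n : nat) :
  1 / 2 <= nu -> is_BesselJ_zeros nu j -> (1 <= n)%nat -> 1 + (INR n - 1) * PI <= j n.
Proof.
intros hnu hj Hn. induction Hn as [|n Hn IH].
- simpl. assert (H := zeros_ge_1 nu j 1 hnu hj (Nat.le_refl 1)). lra.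
- destruct (zeros_gap nu j n 1 hnu hj Hn Rlt_0_1) as [H _].
  rewrite S_INR. apply Rle_trans with (j n + PI / 1); [lra|].
  cut (PI / 1 <= j (S n) - j n); [lra|]. apply H.
  intros x Hx. assert (H1 := zeros_ge_1 nu j n hnu hj Hn).
  assert (0 <= (nu ^ 2 - 1 / 4) / x ^ 2); [|lra].
  apply Rdiv_le_0_compat; [nra | apply pow_lt; lra].
Qed.

Theorem lemma5p2 (nu : R) (hnu : 1 / 2 <= nu)
  (j : nat -> R) (hj : is_BesselJ_zeros nu j) :
  forall n : nat, (1 <= n)%nat -> nu < INR n -> j (S n) - j n <= 2 * PI.
Proof.
intros n Hn Hnun.
destruct (zeros_gap nu j n (1 / 2) hnu hj Hn) as [_ H]; [lra|].
replace (2 * PI) with (PI / (1 / 2)) by field.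
apply H. intros x Hx.
assert (Hge := zeros_ge nu j n hnu hj Hn).
(* This bound gives [PI > 3]. *)
assert (HPI := PI2_3_2).
assert (Hn1 : 1 <= INR n) by (apply (le_INR 1); trivial).
assert (Hx0 : 1 + (INR n - 1) * 3 <= x) by nra.
(* Equivalent to [q x >= 1 / 4], the hypothesis of the comparison with [m = 1 / 2]. *)
assert (Hsq : (4 / 3) * (nu ^ 2 - 1 / 4) <= x ^ 2).
{ assert (nu * nu <= INR n * INR n) by nra.
  (* For [n >= 2], [x >= 3 * n - 2 >= 3 * n / 2], and [9 / 4 > 4 / 3] suffices. This fails at
     [n = 1], where [nu < 1] makes the left side at most 1 while [x >= 1]. *)
  assert (INR n = 1 \/ 2 <= INR n) as [E|E].
  { destruct (Nat.eq_dec n 1) as [->|]; [now left|right]. apply (le_INR 2). lia. }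
  - nra.
  - assert (INR n * (3 / 2) <= x) by lra. nra. }
assert (Hx2 : 0 < x ^ 2) by (apply pow_lt; lra).
assert ((nu ^ 2 - 1 / 4) / x ^ 2 <= 3 / 4); [|lra].
apply Rmult_le_reg_r with (x ^ 2); trivial.
unfold Rdiv at 1. rewrite Rmult_assoc, Rinv_l; lra.
Qed.
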